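(* For every integer $n \geq 2$, the information rate of the king and $n$ pawns access structure $\Gamma_n$ is $$\rho(\Gamma_n)=\frac{n-1}{2n-3}.$$
   Context: Access structures. Let $P$ be a finite set of participants. An access structure $\Gamma$ on $P$ is the (upward closed) collection of all qualified subsets of $P$; subsets of $P$ not in $\Gamma$ are called unqualified. An access structure is determined by, and is specified by listing, its minimal qualified subsets; a set is qualified iff it contains a minimal qualified subset. King and $n$ pawns. For $n\ge 2$, $\Gamma_n$ is the access structure on the $(n+1)$-element set $P_n=\{k,p_1,\dots,p_n\}$ whose minimal qualified subsets are $\{k,p_i\}$ for $1\le i\le n$ and $\{p_1,\dots,p_n\}$. Thus $X\subseteq P_n$ is qualified iff $X$ contains $k$ and at least one $p_i$, or $X\supseteq\{p_1,\dots,p_n\}$. Secret sharing schemes. Let $\Sigma$ be a collection of jointly distributed random variables (taking finitely many values) consisting of one random variable $S$ for the secret, with $H(S)>0$, and one for each participant in $P$. For $X,Y\subseteq P\cup\{S\}$, $H(X)$ denotes the joint Shannon entropy of the random variables of the elements of $X$, $H(X|Y)$ the conditional entropy, and $H(x)=H(\{x\})$. $\Sigma$ is a (perfect) secret sharing scheme for $\Gamma$ if for every $X\subseteq P$: $H(S|X)=0$ if $X\in\Gamma$, and $H(S|X)=H(S)$ if $X\notin\Gamma$. Information rate. For a secret sharing scheme $\Sigma$ and $x\in P$, $\rho(x)=H(S)/H(x)$. The information rate of $\Sigma$ is $\rho(\Sigma)=\min_{x\in P}\rho(x)$. The information rate $\rho(\Gamma)$ of an access structure is the supremum of $\rho(\Sigma)$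 over all secret sharing schemes $\Sigma$ for $\Gamma$. *)

(* Defs.v *)
From HB Require Import structures.
From mathcomp Require Import all_boot all_order all_algebra.
From mathcomp Require Import boolp classical_sets reals ereal exp.

Set Implicit Arguments.
Unset Strict Implicit.
Unset Printing Implicit Defensive.

Import Order.TTheory GRing.Theory Num.Theory.

Local Open Scope ring_scope.

(* The unqualified subsets are those outside [qualified]. *)
Record access_structure (P : finType) := AccessStructure {
  qualified :> {set {set P}};
  qualified_up : forall A B : {set P},
    A \subset B -> A \in qualified -> B \in qualified
}.

Definition generated_sets (P : finType) (M : {set {set P}}) : {set {set P}} :=
  [set X : {set P} | [exists A in M, A \subset X]]%SET.

Lemma generated_sets_up (P : finType) (M : {set {set P}}) (A B : {set P}) :
  A \subset B -> A \in generated_sets M -> B \in generated_sets M.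
Proof.
move=> sAB; rewrite !inE => /existsP[C /andP[CM sCA]].
by apply/existsP; exists C; rewrite CM (fintype.subset_trans sCA sAB).
Qed.

Definition generated (P : finType) (M : {set {set P}}) : access_structure P :=
  AccessStructure (@generated_sets_up P M).

Definition king_pawns_party (n : nat) : finType := (unit + 'I_n)%type.

Definition king (n : nat) : king_pawns_party n := inl tt.
Definition pawn (n : nat) (i : 'I_n) : king_pawns_party n := inr i.

(* For [2 <= n] the listed sets form an antichain, hence they are exactly the
   minimal qualified sets. *)
Definition king_pawns (n : nat) : access_structure (king_pawns_party n) :=
  generated ([set [set king n; pawn i] | i : 'I_n]
             :|: [set [set pawn i | i : 'I_n]])%SET.

(* A finite sample space loses no generality: only the joint law of the finitely
   many finite-valued variables matters below. *)
Record joint_family (R : realType) (I : finType) := JointFamily {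
  sample : finType;
  mass : sample -> R;
  mass_ge0 : forall w, 0 <= mass w;
  mass_sum1 : \sum_w mass w = 1;
  value : I -> finType;
  rv : forall i : I, sample -> value i
}.

Section Entropy.
Context {R : realType} {I : finType}.
Variable Sigma : joint_family R I.

Definition pr (B : finType) (Z : sample Sigma -> B) (b : B) : R :=
  \sum_(w | Z w == b) mass w.

Definition log2 (x : R) : R := ln x / ln 2.

(* The convention [0 log 0 = 0] is automatic, the logarithm being total. *)
Definition shannon (B : finType) (p : B -> R) : R :=
  - \sum_b p b * log2 (p b).

Definition joint (X : {set I}) (w : sample Sigma) :
    {dffun forall i : {i : I | i \in X}, value Sigma (val i)} :=
  [ffun i => rv (val i) w].

Definition H (X : {set I}) : R := shannon (pr (joint X)).

(* Average over the values [y] of [Y] of the entropy of the law of [X]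
   given [Y = y]; the values [y] of probability zero contribute zero. *)
Definition condH (X Y : {set I}) : R :=
  \sum_y pr (joint Y) y *
    shannon (fun x => pr (fun w => (joint X w, joint Y w)) (x, y)
                      / pr (joint Y) y).

End Entropy.

(* Variables are indexed by [option P]: [None] is the secret and [Some x] is
   the share of the participant [x]. *)
Definition secret_sharing_scheme (R : realType) (P : finType)
    (Gamma : access_structure P) (Sigma : joint_family R (option P)) : Prop :=
  0 < H Sigma [set None]%SET /\
  forall X : {set P},
    (X \in qualified Gamma ->
       condH Sigma [set None]%SET (Some @: X)%SET = 0) /\
    (X \notin qualified Gamma ->
       condH Sigma [set None]%SET (Some @: X)%SET = H Sigma [set None]%SET).

(* Extended-real division: the rate of a participant whose share has zero
   entropy is [+oo], so that such participants do not affect the minimum. *)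
Definition participant_rate (R : realType) (P : finType)
    (Sigma : joint_family R (option P)) (x : P) : \bar R :=
  ((H Sigma [set None]%SET)%:E / (H Sigma [set Some x]%SET)%:E)%E.

Definition scheme_rate (R : realType) (P : finType)
    (Sigma : joint_family R (option P)) : \bar R :=
  \big[Order.min/+oo%E]_(x : P) participant_rate Sigma x.

Definition information_rate (R : realType) (P : finType)
    (Gamma : access_structure P) : \bar R :=
  ereal_sup [set r : \bar R | exists Sigma : joint_family R (option P),
    secret_sharing_scheme Gamma Sigma /\ r = scheme_rate Sigma]%classic.

(* Main.v *)
(* Upper bound.  Write h for entropy, k for the king, A_i = {p_0, .., p_(i-1)}
   and gain i = H(k | A_i).  Then gain 1 <= h(k), gain (n-1) >= H(S), and each
   intermediate pawn satisfies gain i + h(p_i) >= gain (i+1) + 2 H(S), so the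
   king and n - 2 pawns hold at least (2n - 3) H(S) together.

   Attainment.  Over Z/(n+1), where n = -1, share a secret of n - 1 coordinates.
   For every coordinate s, pawn i holds x_i with s = x_0 + .. + x_(n-1).  For
   the first coordinate the king holds the values s + x_i, whose sum is
   (n+1) s = 0, so that n - 1 of them suffice and reveal nothing about s; for
   each of the other n - 2 coordinates the king holds a fresh random r and every
   pawn additionally holds s + r.  All shares consist of 2n - 3 symbols. *)
Require Import Defs.
From mathcomp Require Import all_boot all_order all_algebra.
From mathcomp Require Import boolp classical_sets reals ereal exp.
From mathcomp Require Import ring lra zify.

Set Implicit Arguments.
Unset Strict Implicit.
Unset Printing Implicit Defensive.

Import Order.TTheory GRing.Theory Num.Theory.

Local Open Scope ring_scope.

(** * Entropy *)

Section Log.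
Variable R : realType.
Implicit Types x y : R.

Lemma ln2_gt0 : 0 < ln (2 : R).
Proof. by rewrite ln_gt0// ltr1n. Qed.

(** The logarithm lies below its tangent at 1; submodularity and the cardinality bound on entropy
    both rest on this. *)
Lemma log2_le_sub1 x : 0 < x -> log2 x <= (x - 1) / ln 2.
Proof.
move=> x0; rewrite /log2 ler_pM2r ?invr_gt0 ?ln2_gt0//.
have := @le_ln1Dx R (x - 1); rewrite (_ : 1 + (x - 1) = x); last by ring.
by apply; lra.
Qed.

Lemma ler_log2 x y : 0 < x -> x <= y -> log2 x <= log2 y.
Proof.
move=> x0 xy; rewrite /log2 ler_pM2r ?invr_gt0 ?ln2_gt0// ler_ln// posrE//.
exact: lt_le_trans xy.
Qed.

Lemma log2M x y : 0 < x -> 0 < y -> log2 (x * y) = log2 x + log2 y.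
Proof. by move=> x0 y0; rewrite /log2 lnM ?posrE// mulrDl. Qed.

Lemma log2V x : 0 < x -> log2 x^-1 = - log2 x.
Proof. by move=> x0; rewrite /log2 lnV ?posrE// mulNr. Qed.

Lemma log2X x k : 0 < x -> log2 (x ^+ k) = k%:R * log2 x.
Proof. by move=> x0; rewrite /log2 lnXn// mulr_natl mulrnAl. Qed.

Lemma log21 : log2 (1 : R) = 0.
Proof. by rewrite /log2 ln1 mul0r. Qed.

End Log.

Section EntropyTheory.
Variables (R : realType) (I : finType) (Sigma : joint_family R I).
Implicit Types (A B X Y : {set I}) (w u v : sample Sigma).

(** Equality of [joint X] at two outcomes, freed of its dependent function type. *)
Definition agree X w u : bool := [forall i in X, rv i w == rv i u].

Lemma agreeP X w u : reflect {in X, forall i, rv i w = rv i u} (agree X w u).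
Proof. exact: eqfun_inP. Qed.

Lemma agree_refl X w : agree X w w.
Proof. exact/agreeP. Qed.

Lemma agree_sym X w u : agree X w u = agree X u w.
Proof. by apply/agreeP/agreeP => h i iX; rewrite h. Qed.

Lemma agree_trans X w u v : agree X w u -> agree X u v -> agree X w v.
Proof. by move=> /agreeP h /agreeP k; apply/agreeP => i iX; rewrite h// k. Qed.

Lemma agree_sub X Y w u : X \subset Y -> agree Y w u -> agree X w u.
Proof. by move=> /fintype.subsetP s /agreeP h; apply/agreeP => i /s /h. Qed.

Lemma agreeU X Y w u : agree (X :|: Y) w u = agree X w u && agree Y w u.
Proof.
apply/idP/andP => [h|[/agreeP hX /agreeP hY]].
  by split; apply: agree_sub h; rewrite ?finset.subsetUl ?finset.subsetUr.
by apply/agreeP => i; rewrite finset.in_setU => /orP[/hX|/hY].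
Qed.

Lemma agree1 i w u : agree [set i]%SET w u = (rv i w == rv i u).
Proof.
apply/agreeP/eqP => [|e j]; first by apply; rewrite finset.in_set1.
by rewrite finset.in_set1 => /eqP ->.
Qed.

Lemma agree0 w u : agree finset.set0 w u.
Proof. by apply/agreeP => i; rewrite finset.in_set0. Qed.

Lemma joint_eqE X w u : (joint X w == joint X u) = agree X w u.
Proof.
apply/eqP/agreeP => [/ffunP e i iX|h].
  by have := e (exist _ i iX); rewrite /joint !ffunE.
by apply/ffunP => -[i iX]; rewrite /joint !ffunE /= h.
Qed.

(** Probability of the values that the variables in [X] take at [w]. Entropy becomes the mean of
    [- log2 (atom X w)], so that all sums run over one sample space. *)
Definition atom X w : R := \sum_(u | agree X u w) mass u.

Lemma atom_ge0 X w : 0 <= atom X w.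
Proof. by apply: sumr_ge0 => u _; apply: mass_ge0. Qed.

Lemma atom_eq X w u : agree X w u -> atom X w = atom X u.
Proof.
move=> h; apply: eq_bigl => v; apply/idP/idP => k; apply: agree_trans k _ => //.
by rewrite agree_sym.
Qed.

Lemma mass_le_atom X w : mass w <= atom X w.
Proof.
rewrite /atom (bigD1 w) ?agree_refl//= lerDl.
by apply: sumr_ge0 => u _; apply: mass_ge0.
Qed.

Lemma atom_gt0 X w : 0 < mass w -> 0 < atom X w.
Proof. by move=> m0; apply: lt_le_trans (mass_le_atom X w). Qed.

Lemma atom_sub X Y w : X \subset Y -> atom Y w <= atom X w.
Proof.
move=> sXY; rewrite /atom [leRHS](bigID (fun u => agree Y u w)) /=.
rewrite [X in _ <= X + _](eq_bigl (fun u => agree Y u w)); last first.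
  by move=> u; rewrite andb_idl// => /(agree_sub sXY).
by rewrite lerDl sumr_ge0// => u _; apply: mass_ge0.
Qed.

Lemma atom_set0 w : atom finset.set0 w = 1.
Proof.
rewrite -(mass_sum1 Sigma); apply: eq_bigl => u.
by rewrite agree0.
Qed.

Lemma ler_sum_mass (F G : sample Sigma -> R) :
  (forall w, 0 < mass w -> F w <= G w) ->
  \sum_w mass w * F w <= \sum_w mass w * G w.
Proof.
move=> FG; apply: ler_sum => w _.
have := mass_ge0 w; rewrite le_eqVlt => /predU1P[<-|m0]; first by rewrite !mul0r.
by rewrite ler_pM2l// FG.
Qed.

Lemma eq_sum_mass (F G : sample Sigma -> R) :
  (forall w, 0 < mass w -> F w = G w) ->
  \sum_w mass w * F w = \sum_w mass w * G w.
Proof.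
by move=> FG; apply: le_anti; rewrite !ler_sum_mass// => w /FG ->.
Qed.

Lemma sum_pr (B : finType) (Z : sample Sigma -> B) (F : B -> R) :
  \sum_b pr Z b * F b = \sum_w mass w * F (Z w).
Proof.
rewrite [RHS](partition_big Z predT)//=; apply: eq_bigr => b _.
by rewrite /pr mulr_suml; apply: eq_bigr => w /eqP ->.
Qed.

Lemma HE X : H Sigma X = - \sum_w mass w * log2 (atom X w).
Proof.
rewrite /H /shannon sum_pr; congr (- _); apply: eq_bigr => w _.
by congr (_ * log2 _); apply: eq_bigl => u; rewrite joint_eqE.
Qed.

(** Chain rule, the form in which the conditions on a scheme are used. *)
Lemma condHE X Y : condH Sigma X Y = H Sigma (X :|: Y) - H Sigma Y.
Proof.
pose Z w := (joint X w, joint Y w).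
(* At a value [y] of probability zero the factor [pr (joint Y) y] does not cancel; both sides vanish
   because the joint probability does. *)
have prZ x y : pr (joint Y) y = 0 -> pr Z (x, y) = 0.
  move=> /eqP; rewrite psumr_eq0 => [/allP h|w _]; last exact: mass_ge0.
  apply: big1 => w /eqP[_ e]; apply/eqP.
  by have := h w; rewrite mem_index_enum e eqxx; apply.
transitivity (- \sum_x \sum_y pr Z (x, y) *
    log2 (pr Z (x, y) / pr (joint Y) y)).
  rewrite exchange_big /= -sumrN; apply: eq_bigr => y _.
  rewrite /shannon mulrN mulr_sumr; congr (- _); apply: eq_bigr => x _.
  rewrite mulrA; congr (_ * _); have [p0|p0] := eqVneq (pr (joint Y) y) 0.
    by rewrite p0 mul0r prZ.
  by rewrite mulrCA divff// mulr1.
rewrite pair_big /= !HE.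
rewrite (eq_bigr (fun b => pr Z b * log2 (pr Z b / pr (joint Y) b.2))); last first.
  by move=> [].
rewrite sum_pr (eq_sum_mass
    (G := fun w => log2 (atom (X :|: Y) w) - log2 (atom Y w))).
  by under eq_bigr do rewrite mulrBr; rewrite sumrB; ring.
move=> w m0.
have -> : pr Z (Z w) = atom (X :|: Y) w.
  by apply: eq_bigl => u; rewrite xpair_eqE !joint_eqE agreeU.
have -> : pr (joint Y) (Z w).2 = atom Y w.
  by apply: eq_bigl => u; rewrite joint_eqE.
by rewrite log2M ?invr_gt0 ?log2V ?atom_gt0.
Qed.

Lemma H_mono X Y : X \subset Y -> H Sigma X <= H Sigma Y.
Proof.
move=> sXY; rewrite !HE lerN2; apply: ler_sum_mass => w m0.
by rewrite ler_log2 ?atom_gt0// atom_sub.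
Qed.

Lemma H_set0 : H Sigma finset.set0 = 0.
Proof.
by rewrite HE big1 ?oppr0// => w _; rewrite atom_set0 log21 mulr0.
Qed.

(* Since log t <= t - 1, this is what submodularity of entropy reduces to. *)
Lemma sum_mass_ratio_le1 A B :
  \sum_w mass w * (atom A w * atom B w / (atom (A :|: B) w * atom (A :&: B) w))
    <= 1.
Proof.
pose q w := (atom (A :|: B) w * atom (A :&: B) w)^-1.
(* Expand the numerator atoms as sums over [u] and [v], then move the sum over [w] innermost. *)
have -> : \sum_w mass w * (atom A w * atom B w / (atom (A :|: B) w *
      atom (A :&: B) w)) =
    \sum_u mass u * \sum_v mass v *
      \sum_(w | agree A u w && agree B v w) mass w * q w.
  transitivity (\sum_w \sum_u \sum_v
      (if agree A u w && agree B v w then mass u * mass v * (mass w * q w)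
       else 0)).
    apply: eq_bigr => w _; rewrite -/(q w).
    rewrite /atom (big_mkcond (fun u => agree A u w)) /=.
    rewrite (big_mkcond (fun u => agree B u w)) /=.
    rewrite mulrCA mulr_suml mulr_suml; apply: eq_bigr => u _.
    rewrite mulr_sumr mulr_suml; apply: eq_bigr => v _.
    by case: (agree A u w); case: (agree B v w); rewrite /= ?(mul0r, mulr0).
  rewrite exchange_big /=; apply: eq_bigr => u _.
  rewrite exchange_big mulr_sumr /=; apply: eq_bigr => v _.
  rewrite !mulr_sumr -big_mkcond /=; apply: eq_bigr => w _.
  by rewrite !mulrA.
rewrite -[leRHS](mass_sum1 Sigma).
rewrite [leRHS](eq_bigr (fun u => mass u * 1)); last by move=> u; rewrite mulr1.
apply: ler_sum_mass => u m0.
have au0 : 0 < atom (A :&: B) u by exact: atom_gt0.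
(* The inner sum is at most the inverse of the atom of [u], and zero unless [v] agrees with [u] on
   [A :&: B]; averaging this bound over [v] gives 1. *)
apply: (@le_trans _ _ (\sum_v mass v *
    (if agree (A :&: B) v u then (atom (A :&: B) u)^-1 else 0))); last first.
  rewrite (eq_bigr (fun v => (if agree (A :&: B) v u then mass v else 0) *
    (atom (A :&: B) u)^-1)); last first.
    by move=> v _; case: ifP; rewrite ?mulr0 ?mul0r.
  by rewrite -mulr_suml -big_mkcond /= divff// gt_eqF.
apply: ler_sum_mass => v _.
case: (pickP (fun w => agree A u w && agree B v w)) => [w0 /andP[Aw Bw]|no];
  last first.
  by rewrite big_pred0//; case: ifP; rewrite // invr_ge0 ltW.
have Iuw : agree (A :&: B) u w0 by apply: agree_sub Aw; exact: finset.subsetIl.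
have Ivw : agree (A :&: B) v w0 by apply: agree_sub Bw; exact: finset.subsetIr.
have -> : agree (A :&: B) v u by apply: agree_trans Ivw _; rewrite agree_sym.
(* Once one such [w0] exists, the admissible [w] form its atom for [A :|: B], on which [q] is
   constant. *)
have cond w : agree A u w && agree B v w = agree (A :|: B) w w0.
  rewrite agreeU; apply/andP/andP => -[h k]; split.
  - by apply: agree_trans Aw; rewrite agree_sym.
  - by apply: agree_trans Bw; rewrite agree_sym.
  - by apply: agree_trans Aw _; rewrite agree_sym.
  - by apply: agree_trans Bw _; rewrite agree_sym.
rewrite (eq_bigl _ _ cond) (eq_bigr (fun w => mass w * q w0)); last first.
  move=> w h; rewrite /q (atom_eq h) (@atom_eq (A :&: B) w w0)//.
  apply: agree_sub h; apply: fintype.subset_trans (finset.subsetUl A B).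
  exact: finset.subsetIl.
rewrite -mulr_suml -/(atom _ _) /q invfM mulrA (atom_eq Iuw).
have [->|n0] := eqVneq (atom (A :|: B) w0) 0; last by rewrite divff// mul1r.
by rewrite !mul0r invr_ge0 atom_ge0.
Qed.

(** The left side minus the right is the mean of [log2 (r w)], which the tangent bound compares with
    the mean of [r w - 1]. *)
Lemma H_submod A B :
  H Sigma (A :|: B) + H Sigma (A :&: B) <= H Sigma A + H Sigma B.
Proof.
pose r w := atom A w * atom B w / (atom (A :|: B) w * atom (A :&: B) w).
suff : \sum_w mass w * log2 (r w) <= 0.
  have -> : \sum_w mass w * log2 (r w) =
      \sum_w mass w * (log2 (atom A w) + log2 (atom B w) -
        log2 (atom (A :|: B) w) - log2 (atom (A :&: B) w)).
    apply: eq_sum_mass => w m0.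
    by rewrite /r !(log2M, log2V) ?invr_gt0 ?mulr_gt0 ?atom_gt0//; ring.
  under eq_bigr do rewrite !(mulrBr, mulrDr).
  by rewrite !sumrB big_split /= !HE; lra.
apply: (@le_trans _ _ (\sum_w mass w * ((r w - 1) / ln 2))).
  apply: ler_sum_mass => w m0; apply: log2_le_sub1.
  by rewrite divr_gt0 ?mulr_gt0 ?atom_gt0.
under eq_bigr do rewrite mulrA mulrBr mulr1.
rewrite -mulr_suml sumrB mass_sum1 mulr_le0_ge0// ?invr_ge0 ?(ltW (ln2_gt0 R))//.
by rewrite subr_le0 sum_mass_ratio_le1.
Qed.

(** Comparison with the uniform law: the gap is the mean of [log2 (N * atom)], bounded below by the
    tangent inequality at the inverse of [N * atom]. *)
Lemma H1_le_log_card i : H Sigma [set i]%SET <= log2 #|value Sigma i|%:R.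
Proof.
have c0 w : 0 < (#|value Sigma i|%:R : R).
  by rewrite ltr0n; apply/card_gt0P; exists (rv i w).
have [w0 _] : exists w : sample Sigma, true.
  case: (pickP (@predT (sample Sigma))) => [w _|no]; first by exists w.
  by have /eqP := mass_sum1 Sigma; rewrite big_pred0// eq_sym oner_eq0.
have {c0}c0 := c0 w0; set N : R := #|value Sigma i|%:R.
have -> : log2 N = \sum_(w : sample Sigma) mass w * log2 N.
  by rewrite -mulr_suml mass_sum1 mul1r.
rewrite HE -subr_le0 -opprD.
rewrite oppr_le0 -big_split /=.
(* Each value of positive probability contributes exactly 1, any other value 0. *)
have sum_le : \sum_w mass w * (atom [set i]%SET w)^-1 <= N.
  rewrite (partition_big (rv i) predT)//= /N -sum1_card natr_sum.
  apply: ler_sum => b _; rewrite mulr1n.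
  pose p := \sum_(w | rv i w == b) mass w : R.
  rewrite (eq_bigr (fun w => mass w * p^-1)); last first.
    move=> w /eqP wb; congr (_ * _^-1); apply: eq_bigl => u.
    by rewrite agree1 wb.
  rewrite -mulr_suml -/p.
  by have [->|n0] := eqVneq p 0; rewrite ?mul0r ?divff.
apply: (@le_trans _ _ (\sum_w mass w *
    ((1 - (N * atom [set i]%SET w)^-1) / ln 2))).
  under eq_bigr do rewrite mulrA mulrBr mulr1 invfM mulrCA.
  rewrite -mulr_suml sumrB mass_sum1 -mulr_sumr.
  apply: mulr_ge0; last by rewrite invr_ge0 ltW// ln2_gt0.
  by rewrite subr_ge0 mulrC ler_pdivrMr// mul1r.
under [leRHS]eq_bigr do rewrite -mulrDr.
apply: ler_sum_mass => w m0; have a0 := atom_gt0 [set i]%SET m0.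
have := @log2_le_sub1 R (N * atom [set i]%SET w)^-1.
rewrite invr_gt0 mulr_gt0// log2V ?mulr_gt0// log2M// => /(_ isT).
by rewrite !mulrBl; lra.
Qed.

Lemma H_determined X Y :
  (forall w u, agree X w u -> agree Y w u) ->
  H Sigma (Y :|: X) = H Sigma X.
Proof.
move=> h; rewrite !HE; congr (- _); apply: eq_bigr => w _; congr (_ * log2 _).
by apply: eq_bigl => u; rewrite agreeU; apply/andP/idP => [[]|k] //; split; auto.
Qed.

(** Independence by symmetry: a mass-preserving injection that keeps [X] and carries [a] to [b]
    shows that all values of variable [i] are equally likely inside each atom of [X]. *)
Lemma H_independent i X :
  (forall a b : value Sigma i, exists2 g : sample Sigma -> sample Sigma,
     injective g & forall w, [/\ mass (g w) = mass w, agree X (g w) w &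
       rv i w = a -> rv i (g w) = b]) ->
  H Sigma ([set i]%SET :|: X) = log2 #|value Sigma i|%:R + H Sigma X.
Proof.
move=> hg.
pose c w b := \sum_(u | agree X u w && (rv i u == b)) mass u : R.
have c_le w a b : c w a <= c w b.
  have [g g_inj gP] := hg a b.
  rewrite /c [leRHS](reindex_inj g_inj) big_mkcond [leRHS]big_mkcond /=.
  apply: ler_sum => u _; have [-> agu rgu] := gP u.
  have -> : agree X (g u) w = agree X u w.
    apply/idP/idP; apply: agree_trans => //; by rewrite agree_sym.
  case: (agree X u w) => //=; case: eqP => [/rgu -> |_]; first by rewrite eqxx.
  by case: ifP; rewrite ?mass_ge0.
have atomE w : atom X w = #|value Sigma i|%:R * atom ([set i]%SET :|: X) w.
  rewrite /atom (partition_big (rv i) predT)//=.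
  rewrite (eq_bigr (fun=> c w (rv i w))); last first.
    by move=> b _; apply: le_anti; rewrite -/(c w b) !c_le.
  rewrite sumr_const mulr_natl; congr (_ *+ _); apply: eq_bigl => u.
  by rewrite agreeU agree1 andbC.
have N0 w : 0 < (#|value Sigma i|%:R : R).
  by rewrite ltr0n; apply/card_gt0P; exists (rv i w).
rewrite !HE [X in _ = _ - X](eq_sum_mass (G := fun w =>
    log2 #|value Sigma i|%:R + log2 (atom ([set i]%SET :|: X) w))).
  by under [in RHS]eq_bigr do rewrite mulrDr;
    rewrite big_split -mulr_suml mass_sum1 /=; ring.
by move=> w m0; rewrite atomE log2M ?atom_gt0 ?(N0 w).
Qed.

End EntropyTheory.

(** * Entropies of the shares of a scheme *)

Section SchemePolymatroid.
Variables (R : realType) (P : finType) (Gamma : access_structure P).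
Variable Sigma : joint_family R (option P).
Hypothesis schemeP : secret_sharing_scheme Gamma Sigma.
Implicit Types A B C D : {set P}.

Definition share_entropy A : R := H Sigma (Some @: A)%SET.
Local Notation h := share_entropy.
Local Notation hS := (H Sigma [set None]%SET).

Lemma share_entropy_mono A B : A \subset B -> h A <= h B.
Proof. by move=> sAB; apply: H_mono; apply: imsetS. Qed.

Lemma share_entropy_set0 : h finset.set0 = 0.
Proof. by rewrite /h imset0 H_set0. Qed.

(** Inclusions in place of the exact union and intersection, absorbed by monotonicity, spare set
    identities at each use. *)
Lemma share_entropy_submod A B C D :
  C \subset A :|: B -> D \subset A :&: B -> h C + h D <= h A + h B.
Proof.
move=> /share_entropy_mono sC /share_entropy_mono sD.
apply: le_trans (lerD sC sD) _.
rewrite /h imsetU imsetI; first exact: H_submod.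
by move=> x y _ _ [].
Qed.

Lemma H_secret_qualified A : A \in qualified Gamma ->
  H Sigma ([set None] :|: Some @: A)%SET = h A.
Proof.
by move=> /((schemeP.2 A).1) /eqP; rewrite condHE subr_eq0 => /eqP.
Qed.

Lemma H_secret_unqualified A : A \notin qualified Gamma ->
  H Sigma ([set None] :|: Some @: A)%SET = hS + h A.
Proof.
by move=> /((schemeP.2 A).2); rewrite condHE => <-; rewrite subrK.
Qed.

(** Adjoining the secret is free on the qualified [B] and adds [hS] on the unqualified [A]. *)
Lemma share_entropy_strict_mono A B : A \subset B ->
  A \notin qualified Gamma -> B \in qualified Gamma -> hS + h A <= h B.
Proof.
move=> sAB nA qB; rewrite -H_secret_unqualified// -H_secret_qualified//.
by apply: H_mono; apply: finset.setUS; apply: imsetS.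
Qed.

(** Submodularity after adjoining the secret to [A] and [B], which is free there but adds [hS] on
    their intersection. *)
Lemma share_entropy_strict_submod A B C :
  A \in qualified Gamma -> B \in qualified Gamma ->
  A :&: B \notin qualified Gamma -> C \subset A :|: B ->
  h C + (hS + h (A :&: B)) <= h A + h B.
Proof.
move=> qA qB nAB /share_entropy_mono sC.
apply: le_trans (lerD sC (lexx _)) _.
rewrite -(H_secret_qualified qA) -(H_secret_qualified qB).
rewrite -H_secret_unqualified// -H_secret_qualified; last first.
  by apply: qualified_up qA; exact: finset.subsetUl.
apply: le_trans (H_submod _ _ _); rewrite imsetU imsetI; last first.
  by move=> x y _ _ [].
by rewrite finset.setUUr finset.setUIr.
Qed.

End SchemePolymatroid.

(** * The upper bound for the king and pawns *)

Section KingPawns.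
Variable n : nat.
Local Notation party := (king_pawns_party n).
Implicit Types X : {set party}.

Lemma king_pawns_qualified X :
  (X \in qualified (king_pawns n)) =
  (king n \in X) && [exists i, pawn i \in X] || [forall i, pawn i \in X].
Proof.
rewrite inE; apply/existsP/orP => [[A]|].
  rewrite !inE => /andP[/orP[/imsetP[i _ ->]|/eqP ->] /fintype.subsetP s].
    left; rewrite s ?inE ?eqxx//=; apply/existsP; exists i.
    by rewrite s ?inE ?eqxx ?orbT.
  by right; apply/forallP => i; apply: s; apply: imset_f.
move=> [/andP[kX /existsP[i iX]]|/forallP aX].
  exists [set king n; pawn i]%SET; rewrite !inE; apply/andP; split.
    by apply/orP; left; apply/imsetP; exists i.
  by apply/fintype.subsetP => x; rewrite !inE => /orP[] /eqP ->.
exists [set pawn i | i : 'I_n]%SET; rewrite !inE eqxx orbT/=.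
by apply/fintype.subsetP => x /imsetP[i _ ->].
Qed.

Definition first_pawns (j : nat) : {set party} :=
  [set x : party | if x is inr i then (i < j)%N else false]%SET.

Variables (R : realType) (Sigma : joint_family R (option party)).
Hypothesis schemeP : secret_sharing_scheme (king_pawns n) Sigma.
Local Notation h := (share_entropy Sigma).
Local Notation hS := (H Sigma [set None]%SET).

Let gain j := h (king n |: first_pawns j)%SET - h (first_pawns j).

(* I(k ; p_i | p_0 .. p_(i-1)) + H(p_i) >= 2 H(S): the sum is at least
   H(p_i | p_0 .. p_(i-1)) + I(p_i ; p_0 .. p_(i-1) | k), and both terms are
   at least H(S). *)
Lemma gain_step (i : 'I_n) : (0 < i)%N -> (i.+1 < n)%N ->
  2 * hS + gain i.+1 <= gain i + h [set pawn i]%SET.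
Proof.
move=> i0 iSn; pose o0 := Ordinal (ltn_trans i0 (ltn_ord i)).
pose all := first_pawns n.
have e1 : h [set king n; pawn i]%SET + h finset.set0 <=
    h [set king n]%SET + h [set pawn i]%SET.
  by apply: share_entropy_submod; rewrite ?finset.sub0set.
(* Both sets are qualified, the second because [0 < i] puts a pawn in [first_pawns i], and they meet
   in the king alone. This yields one copy of [hS]. *)
have e2 : h (king n |: first_pawns i.+1)%SET + (hS + h [set king n]%SET) <=
    h [set king n; pawn i]%SET + h (king n |: first_pawns i)%SET.
  have eI : [set king n]%SET =
      ([set king n; pawn i] :&: (king n |: first_pawns i))%SET.
    apply/finset.setP => -[[]|j]; rewrite !inE//=.
    by apply/esym/negP => /andP[/eqP[->]]; rewrite ltnn.
  have := @share_entropy_strict_submod _ _ _ _ schemeP [set king n; pawn i]%SET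
    (king n |: first_pawns i)%SET (king n |: first_pawns i.+1)%SET.
  rewrite -eI; apply.
  - rewrite king_pawns_qualified !inE eqxx; apply/orP; left.
    by apply/existsP; exists i; rewrite !inE eqxx.
  - rewrite king_pawns_qualified !inE eqxx; apply/orP; left.
    by apply/existsP; exists o0; rewrite !inE.
  - rewrite king_pawns_qualified negb_or; apply/andP; split.
      by rewrite negb_and; apply/orP; right; apply/existsPn => j; rewrite !inE.
    by apply/forallPn; exists i; rewrite !inE.
  - apply/fintype.subsetP => -[[]|j]; rewrite !inE//= ltnS leq_eqVlt.
    by move=> /orP[/eqP/val_inj ->|->]; rewrite ?eqxx ?orbT.
(* Pawn [i] is at least as uncertain given [first_pawns i] as given all other pawns; by [e4] this
   yields the other copy of [hS]. *)
have e3 : h all + h (first_pawns i) <=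
    h (first_pawns i.+1) + h (all :\ pawn i)%SET.
  apply: share_entropy_submod; apply/fintype.subsetP => -[[]|j]; rewrite !inE//=.
    by move=> ->; rewrite andbT; case: eqP => [[->]|]; rewrite ?ltnS ?leqnn ?orbT.
  move=> ji; rewrite ltn_ord ltnS ltnW//= andbT.
  by apply/eqP => -[e]; rewrite e ltnn in ji.
have e4 : hS + h (all :\ pawn i)%SET <= h all.
  apply: (share_entropy_strict_mono schemeP); first exact: subD1set.
    rewrite king_pawns_qualified !inE/=.
    by apply/forallPn; exists i; rewrite !inE eqxx.
  rewrite king_pawns_qualified; apply/orP; right.
  by apply/forallP => j; rewrite !inE /= ltn_ord.
by move: e1 e2 e3 e4; rewrite /gain share_entropy_set0; lra.
Qed.

(** The witness has the largest share entropy [M]. Telescoping [gain_step] over pawns 1 to [n - 2]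
    leads from [gain 1 <= M] to [gain n.-1 >= hS]. *)
Lemma king_pawns_max_share : (2 <= n)%N -> exists x : party,
  (2 * n%:R - 3) * hS <= (n%:R - 1) * H Sigma [set Some x]%SET.
Proof.
move=> n2.
have [x _ xmax] := @arg_maxP _ R party (king n) predT
  (fun x => h [set x]%SET) isT.
exists x; rewrite -imset_set1 -/(h _).
set M := h [set x]%SET in xmax *.
have hM y : h [set y]%SET <= M by exact: xmax.
have gain1 : gain 1 <= M.
  apply: le_trans (hM (king n)).
  rewrite /gain lerBlDr -[leLHS]addr0 -(share_entropy_set0 Sigma).
  by apply: share_entropy_submod; rewrite ?finset.sub0set.
have gainS j : (j.+1 < n)%N ->
    2 * j%:R * hS + gain j.+1 <= (j%:R + 1) * M.
  elim: j => [|j IH] jn; first by rewrite mulr0 mul0r !add0r mul1r.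
  have := @gain_step (Ordinal (ltnW jn)) isT jn.
  have := hM (pawn (Ordinal (ltnW jn))); have := IH (ltnW jn).
  by rewrite -[j.+1%:R]natr1 /=; lra.
(* The pawns before the last are unqualified; the king completes them, as [2 <= n] leaves at least
   one. *)
have gain_last : hS <= gain n.-1.
  rewrite /gain lerBrDr.
  apply: (share_entropy_strict_mono schemeP); first exact: finset.subsetUr.
    rewrite king_pawns_qualified !inE/=.
    have n1 : (n.-1 < n)%N by lia.
    by apply/forallPn; exists (Ordinal n1); rewrite !inE /= ltnn.
  rewrite king_pawns_qualified !inE eqxx/=; apply/orP; left.
  have n0 : (0 < n)%N by lia.
  by apply/existsP; exists (Ordinal n0); rewrite !inE/=; lia.
move: (gainS n.-2) gain_last.
have -> : n.-2.+1 = n.-1 by lia.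
have -> : (n.-2%:R : R) = n%:R - 2 by rewrite -natrB//; congr _%:R; lia.
have -> : (n.-1 < n)%N by lia.
by move=> /(_ isT); lra.
Qed.

Lemma king_pawns_scheme_rate_le : (2 <= n)%N ->
  (scheme_rate Sigma <= ((n%:R - 1) / (2 * n%:R - 3))%:E)%E.
Proof.
move=> n2; have [x hx] := king_pawns_max_share n2.
apply: le_trans (bigmin_le _ x _) _.
have n2R : (2 : R) <= n%:R by rewrite ler_nat.
have hS0 := schemeP.1.
(* A share of zero entropy would have rate [+oo]; the bound [hx] excludes this. *)
have hx0 : 0 < H Sigma [set Some x]%SET.
  have : 0 < (2 * n%:R - 3) * hS by apply: mulr_gt0 => //; lra.
  by move=> /lt_le_trans /(_ hx); rewrite pmulr_rgt0//; lra.
rewrite /participant_rate inver gt_eqF// -EFinM lee_fin.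
rewrite ler_pdivrMr// mulrAC ler_pdivlMr; last by lra.
by rewrite mulrC.
Qed.

End KingPawns.

(** * A scheme attaining the bound *)

Section OptimalScheme.
Variables (R : realType) (m : nat).
Local Notation n := m.+2.
Local Notation party := (king_pawns_party n).
Local Notation G := 'I_m.+3.

(** The pawns' summands for all coordinates, then the pads for the coordinates after the first. The
    secret is not drawn separately but read off as sums. *)
Local Notation randomness :=
  ({ffun 'I_m.+1 * 'I_n -> G} * {ffun 'I_m -> G})%type.
Local Notation secret_type := {ffun 'I_m.+1 -> G}.
Local Notation share_type := ({ffun 'I_m.+1 -> G} * {ffun 'I_m -> G})%type.

Definition secret_coord (w : randomness) (t : 'I_m.+1) : G :=
  \sum_(i < n) w.1 (t, i).

Definition king_value (w : randomness) (i : 'I_n) : G :=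
  secret_coord w ord0 + w.1 (ord0, i).

Definition king_share (w : randomness) : share_type :=
  ([ffun i => king_value w (widen_ord (leqnSn m.+1) i)], w.2).

Definition pawn_share (i : 'I_n) (w : randomness) : share_type :=
  ([ffun t => w.1 (t, i)], [ffun t => secret_coord w (lift ord0 t) + w.2 t]).

Definition scheme_value (o : option party) : finType :=
  if o is Some _ then share_type else secret_type.

Definition scheme_rv (o : option party) : randomness -> scheme_value o :=
  match o with
  | None => fun w => [ffun t => secret_coord w t]
  | Some (inl _) => king_share
  | Some (inr i) => pawn_share i
  end.

Let mass0 (w : randomness) : R := #|{: randomness}|%:R^-1.

Let mass0_ge0 w : 0 <= mass0 w.
Proof. by rewrite invr_ge0. Qed.

Let mass0_sum1 : \sum_w mass0 w = 1.
Proof.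
rewrite sumr_const -[_ *+ _]mulr_natl divff// pnatr_eq0 -lt0n.
by apply/card_gt0P; exists 0.
Qed.

Definition optimal_scheme : joint_family R (option party) :=
  JointFamily mass0_ge0 mass0_sum1 scheme_rv.

(** * Reconstruction of the secret *)

Lemma mulrn_order (s : G) : s *+ m.+3 = 0.
Proof. by apply: val_inj; rewrite Zp_mulrn /= modnMl. Qed.

Lemma sum_king_value w : \sum_i king_value w i = 0.
Proof.
rewrite big_split /= sumr_const card_ord -/(secret_coord w ord0).
by rewrite -mulrSr mulrn_order.
Qed.

Lemma king_share_value w u : king_share w = king_share u ->
  king_value w =1 king_value u.
Proof.
move=> [/ffunP e _].
have ew i : king_value w (widen_ord (leqnSn m.+1) i) =
    king_value u (widen_ord (leqnSn m.+1) i).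
  by have := e i; rewrite !ffunE.
(* The value left out of the king's share is recovered from the zero sum. *)
have emax : king_value w ord_max = king_value u ord_max.
  have : \sum_i king_value w i = \sum_i king_value u i by rewrite !sum_king_value.
  rewrite (big_ord_recr _ (king_value w)).
  rewrite (big_ord_recr _ (king_value u)) /=.
  by under eq_bigr do rewrite ew; exact: addrI.
move=> i; have [im|im] := ltnP i m.+1.
  have -> : i = widen_ord (leqnSn m.+1) (Ordinal im) by exact: val_inj.
  exact: ew.
have -> : i = ord_max by apply: val_inj => /=; have := ltn_ord i; lia.
exact: emax.
Qed.

(** The first coordinate is [king_value w i] minus the pawn's summand, any other one the pawn's
    masked symbol minus the king's pad; all pawns together add their summands. *)
Lemma scheme_correct (X : {set party}) (w u : randomness) :
  X \in qualified (king_pawns n) ->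
  {in X, forall x, scheme_rv (Some x) w = scheme_rv (Some x) u} ->
  secret_coord w =1 secret_coord u.
Proof.
rewrite king_pawns_qualified => /orP[/andP[kX /existsP[i iX]]|/forallP aX] e t.
- have ek := e _ kX; have [/ffunP ei1 /ffunP ei2] := e _ iX.
  have [j|] := unliftP ord0 t; last first.
    move=> ->; have := king_share_value ek i; rewrite /king_value.
    by have := ei1 ord0; rewrite !ffunE => -> /addIr.
  by move=> ->; have := ei2 j; rewrite !ffunE; case: ek => _ -> /addIr.
- apply: eq_bigr => i _; have [/ffunP /(_ t)] := e _ (aX i).
  by rewrite !ffunE.
Qed.

(** * Privacy by translation of the randomness *)

Lemma secret_coordD w v t :
  secret_coord (w + v) t = secret_coord w t + secret_coord v t.
Proof. by rewrite -big_split; apply: eq_bigr => i _; rewrite ffunE. Qed.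

Lemma king_shareD w v : king_share v = 0 -> king_share (w + v) = king_share w.
Proof.
move=> [/ffunP v1 v2]; congr pair; last by rewrite /= v2 addr0.
apply/ffunP => i; have := v1 i.
by rewrite !ffunE /king_value secret_coordD /= !ffunE addrACA => ->; rewrite addr0.
Qed.

Lemma pawn_shareD i w v :
  pawn_share i v = 0 -> pawn_share i (w + v) = pawn_share i w.
Proof.
move=> [/ffunP v1 /ffunP v2]; congr pair; apply/ffunP => t.
  by have := v1 t; rewrite !ffunE => ->; rewrite addr0.
by have := v2 t; rewrite !ffunE secret_coordD addrACA => ->; rewrite addr0.
Qed.

(** Shares are additive in the randomness, so it suffices that [v] has secret [d] and zero shares on
    [X]. *)
Lemma scheme_private (X : {set party}) (d : secret_type) :
  X \notin qualified (king_pawns n) ->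
  exists2 v : randomness, secret_coord v =1 d &
    forall w, {in X, forall x, scheme_rv (Some x) (w + v) = scheme_rv (Some x) w}.
Proof.
rewrite king_pawns_qualified negb_or negb_and => /andP[nK /forallPn[j jX]].
have sum1 (j0 : 'I_n) (c : G) : \sum_(i < n) (if i == j0 then c else 0) = c.
  by rewrite -big_mkcond big_pred1_eq.
have [kX|kX] := boolP (king n \in X).
- have {}nK i : pawn i \notin X.
    by move: nK; rewrite kX => /existsPn; apply.
  (* In the first coordinate [n] summands [- d ord0] add up to [d ord0], since [n = -1] in [G], and
     each [king_value] is zero. Elsewhere the king sees no summand, so pawn 0 carries the shift. *)
  pose v : randomness := ([ffun p => if p.1 == ord0 then - d ord0
    else if p.2 == ord0 then d p.1 else 0], 0).
  have vd : secret_coord v =1 d.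
    move=> t; rewrite /secret_coord.
    under eq_bigr do rewrite ffunE /=.
    have [->|_] := eqVneq t ord0; last exact: sum1.
    rewrite sumr_const card_ord mulNrn; apply/eqP.
    by rewrite eq_sym -addr_eq0 -mulrS mulrn_order.
  exists v => // w [[]|i] xX; last by rewrite (negbTE (nK i)) in xX.
  apply: king_shareD; congr pair; apply/ffunP => i.
  by rewrite !ffunE /king_value vd ffunE /= subrr.
(* The absent pawn [j] carries the whole shift; the pads move by the opposite amount to keep the
   masked symbols fixed. *)
- pose v : randomness := ([ffun p => if p.2 == j then d p.1 else 0],
    [ffun t => - d (lift ord0 t)]).
  have vd : secret_coord v =1 d.
    move=> t; rewrite /secret_coord.
    by under eq_bigr do rewrite ffunE /=; exact: sum1.
  exists v => // w [[]|i] xX; first by rewrite xX in kX.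
  apply: pawn_shareD; congr pair; apply/ffunP => t; rewrite !ffunE /=.
    by case: eqP => // ij; rewrite -ij xX in jX.
  by rewrite vd subrr.
Qed.

(** * Entropies and rate of the scheme *)

Local Notation hS := (H optimal_scheme [set None]%SET).

Lemma scheme_agree (X : {set party}) (w u : randomness) :
  {in X, forall x, scheme_rv (Some x) w = scheme_rv (Some x) u} ->
  @agree _ _ optimal_scheme (Some @: X)%SET w u.
Proof. by move=> e; apply/agreeP => _ /imsetP[x xX ->]; exact: e. Qed.

(** Translation by the vector for [b - a] preserves the uniform mass and the shares in [X], and
    carries secret [a] to [b]. *)
Lemma scheme_H_unqualified (X : {set party}) :
  X \notin qualified (king_pawns n) ->
  H optimal_scheme ([set None] :|: Some @: X)%SET =
  log2 #|{: secret_type}|%:R + H optimal_scheme (Some @: X)%SET.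
Proof.
move=> nX; apply: H_independent => a b.
have [v vd vX] := scheme_private (b - a) nX.
exists (fun w : randomness => w + v); first exact: addIr.
move=> w; split=> //; first exact: scheme_agree.
move=> /= /ffunP wa; apply/ffunP => t; have := wa t.
by rewrite !ffunE secret_coordD vd !ffunE => ->; rewrite addrC subrK.
Qed.

(** Privacy against the empty set makes the secret uniform. *)
Lemma scheme_H_secret : hS = m.+1%:R * log2 (m.+3%:R : R).
Proof.
have := @scheme_H_unqualified finset.set0; rewrite imset0 H_set0 finset.setU0.
rewrite addr0 card_ffun !card_ord natrX log2X ?ltr0n//; apply.
rewrite king_pawns_qualified !inE/=; apply/forallPn.
by exists ord0; rewrite inE.
Qed.

Lemma scheme_H_share (x : party) :
  H optimal_scheme [set Some x]%SET <= (2 * m + 1)%:R * log2 (m.+3%:R : R).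
Proof.
apply: le_trans (H1_le_log_card _ _) _.
rewrite card_prod !card_ffun !card_ord -expnD natrX log2X ?ltr0n//.
by have -> : (m.+1 + m = 2 * m + 1)%N by lia.
Qed.

Let log_gt0 : 0 < log2 (m.+3%:R : R).
Proof. by rewrite /log2 divr_gt0 ?ln2_gt0// ln_gt0// ltr1n. Qed.

Lemma optimal_schemeP : secret_sharing_scheme (king_pawns n) optimal_scheme.
Proof.
split; first by rewrite scheme_H_secret mulr_gt0.
move=> X; split=> [qX|nX]; rewrite condHE.
  apply/eqP; rewrite subr_eq0; apply/eqP; apply: H_determined => w u.
  move=> /agreeP e; rewrite agree1; apply/eqP/ffunP => t; rewrite !ffunE.
  by apply: (scheme_correct qX) => x xX; exact: (e (Some x) (imset_f _ xX)).
rewrite scheme_H_unqualified// addrK scheme_H_secret.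
by rewrite card_ffun !card_ord natrX log2X ?ltr0n.
Qed.

Lemma optimal_scheme_rate_ge :
  (((n%:R - 1) / (2 * n%:R - 3))%:E <= scheme_rate optimal_scheme)%E.
Proof.
apply/bigmin_geP; split=> [|x _]; first by rewrite leey.
(* Zero entropy gives rate [+oo], so that case is settled separately. *)
rewrite /participant_rate inver; case: eqP => [_|/eqP hx0].
  by rewrite gt0_muley ?leey// lte_fin scheme_H_secret mulr_gt0.
have hx : 0 < H optimal_scheme [set Some x]%SET.
  by rewrite lt_neqAle eq_sym hx0 -(H_set0 optimal_scheme) H_mono// finset.sub0set.
have -> : (n%:R : R) = m%:R + 2 by rewrite -natrD addn2.
have m0 : (0 : R) <= m%:R by [].
rewrite -EFinM lee_fin ler_pdivlMr// mulrAC ler_pdivrMr; last by lra.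
rewrite scheme_H_secret -[m.+1%:R]natr1.
have := scheme_H_share x; rewrite natrD natrM.
set L := log2 _; set h := H _ _ => hL.
apply: (@le_trans _ _ ((m%:R + 1) * ((2 * m%:R + 1) * L))); last by nra.
have -> : m%:R + 2 - 1 = m%:R + 1 :> R by ring.
by rewrite ler_wpM2l//; lra.
Qed.

End OptimalScheme.

Theorem theorem1 (R : realType) (n : nat) (hn : (2 <= n)%N) :
  information_rate R (king_pawns n) = ((n%:R - 1) / (2 * n%:R - 3))%:E.
Proof.
apply: le_anti; apply/andP; split.
  by apply: ge_ereal_sup => _ [Sigma [schemeP ->]]; exact: king_pawns_scheme_rate_le.
(* With [n = m + 2] the explicit scheme attains the supremum. *)
case: n hn => [|[|m]]// _; apply: le_trans (optimal_scheme_rate_ge R m) _.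
apply: ereal_sup_ubound; exists (optimal_scheme R m).
by split => //; exact: optimal_schemeP.
Qed.
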